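(* For ST-MSP, the $k$-ratio satisfies $\alpha_k\le 1+\frac{2}{\lfloor\lg\lfloor k/(\Delta-1)\rfloor\rfloor}$ for every integer $k\ge 2\Delta-2$, where $\lg$ is the logarithm base $2$.
   Context: Setting: a normed space $(M,d)$; $\Delta$ is the maximum number of points in a unit ball with pairwise distances larger than $1$. The unit-disk graph of $V\subseteq M$ has an edge $uv$ whenever $d(u,v)\le1$. ST-MSP: given finite $R\subseteq M$, find a minimum-size set $S\subseteq M$ (points may share locations) such that $R$ lies in one connected component of the unit-disk graph of $R\cup S$; $\mathrm{opt}(I)$ is this minimum. For an instance $I$ with terminal set $R$ and $2\le k\le |R|$, let $\mathcal{H}_k$ be the hypergraph on $R$ with hyperedges all $A\subseteq R$ with $2\le|A|\le k$, each of cost $c^*(A)=$ the optimum of the ST-MSP instance with terminal set $A$; $\tau_k(I)$ is the minimum $c^*$-cost of a connected spanning sub-hypergraph of $\mathcal{H}_k$, and $\alpha_k=\sup_I\tau_k(I)/\mathrm{opt}(I)$ over all ST-MSP instances. *)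

(* Defs.v *)
From mathcomp Require Import all_boot all_order all_algebra finmap.
From mathcomp Require Import all_classical all_reals all_analysis.

Set Implicit Arguments.
Unset Strict Implicit.
Unset Printing Implicit Defensive.

Import Order.TTheory GRing.Theory Num.Theory.
Import numFieldNormedType.Exports.

Local Open Scope classical_set_scope.
Local Open Scope fset_scope.
Local Open Scope ring_scope.

Section STMSP.
Variables (R : realType) (M : normedModType R).

Definition unit_packing (A : {fset M}) : Prop :=
  (exists c : M, {in A, forall x, `|x - c| <= 1}) /\
  {in A &, forall x y, x != y -> 1 < `|x - y|}.

Definition is_packing_number (D : nat) : Prop :=
  (exists2 A : {fset M}, unit_packing A & #|` A| = D) /\
  (forall A : {fset M}, unit_packing A -> (#|` A| <= D)%N).

(* The vertices are abstract and [loc] gives their locations, so that distinct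
   vertices may share a location. *)
Definition unit_disk (V : finType) (loc : V -> M) : rel V :=
  [rel u v | (u != v) && (`|loc u - loc v| <= 1)].

Definition location (T : {fset M}) (n : nat) (S : n.-tuple M)
    (v : T + 'I_n) : M :=
  match v with inl t => val t | inr i => tnth S i end.

Definition steiner_feasible (T : {fset M}) (n : nat) (S : n.-tuple M) : Prop :=
  forall s t : T, connect (unit_disk (location S)) (inl s) (inl t).

(* The infimum of a set of naturals: a minimum, since the set is nonempty. *)
Definition opt (T : {fset M}) : \bar R :=
  ereal_inf [set (n%:R : R)%:E | n in
    [set n : nat | exists S : n.-tuple M, steiner_feasible T S]].

Definition hyperedge (k : nat) (T A : {fset M}) : bool :=
  (A `<=` T)%fset && (2 <= #|` A| <= k)%N.

Definition hyper_adj (T : {fset M}) (F : {fset {fset M}}) : rel T :=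
  [rel u v : T | [exists A : F, (val u \in val A) && (val v \in val A)]].

Definition connected_spanning (k : nat) (T : {fset M}) (F : {fset {fset M}})
    : Prop :=
  {in F, forall A, hyperedge k T A} /\
  (forall u v : T, connect (@hyper_adj T F) u v).

(* Also a minimum: the range of F is finite, and nonempty when 2 <= k. *)
Definition tau (k : nat) (T : {fset M}) : \bar R :=
  ereal_inf [set (\sum_(A <- F) opt A)%E | F in
    [set F : {fset {fset M}} | connected_spanning k T F]].

(* Division of extended reals: a / 0 is +oo for a > 0, and 0 / 0 is 0. Hence an
   instance with [opt T = 0] is harmless exactly when [tau k T = 0]. *)
Definition k_ratio (k : nat) : \bar R :=
  ereal_sup [set (tau k T / opt T)%E | T in [set: {fset M}]].

End STMSP.

Definition lg (R : realType) (x : R) : R := ln x / ln 2.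

(* Main.v *)
(** Fix a feasible set of Steiner points and call two of them linked when they
    are at distance at most 1 and no connected component of the terminals is
    within reach of both. Discarding the other edges between Steiner points
    does not disconnect anything, since the common component replaces them. If
    [i] is linked to [j], adding [j] to representatives of the components seen
    by [i] gives a packing of the unit ball around [i], so [i] sees at most
    [Delta - 1] components.

    Each cluster of linked Steiner points is then split as in the theorem of
    Borchers and Du on k-restricted Steiner trees: grow a spanning tree by
    binary joins, cut it every [q] joins, and extend each piece below a cut by a
    shortest path to a representative, so that a piece touches at most [2 ^ q]
    Steiner points carrying representatives. Summed over the [q] possible
    offsets of the cuts, the excess is at most twice the size of the tree, hence
    some offset costs at most [1 + 2 / q] times the number of Steiner points. *)

Require Import Defs.
From mathcomp Require Import all_boot zify.

Set Implicit Arguments.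
Unset Strict Implicit.
Unset Printing Implicit Defensive.

Lemma connect_homo (V W : finType) (e : rel V) (e' : rel W) (f : V -> W) :
  (forall x y, e x y -> connect e' (f x) (f y)) ->
  forall x y, connect e x y -> connect e' (f x) (f y).
Proof.
move=> ee' x y /connectP[p xp ->] {y}.
elim: p x xp => //= y p IH x /andP[xy yp].
exact: connect_trans (ee' _ _ xy) (IH _ yp).
Qed.

(** * Rooted trees in a finite graph, built by binary joins *)

Section RootedTrees.
Variables (V : finType) (e : rel V).

Inductive rooted_tree : V -> {set V} -> Prop :=
| rooted_tree1 r : rooted_tree r [set r]
| rooted_treeU r A s B : rooted_tree r A -> rooted_tree s B -> e r s ->
    [disjoint A & B] -> rooted_tree r (A :|: B).

Lemma rooted_tree_root r A : rooted_tree r A -> r \in A.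
Proof. by elim=> [x|x A' s B _ rA _ _ _ _]; rewrite !inE ?rA. Qed.

Lemma rooted_tree_cons r s B :
  rooted_tree s B -> e r s -> r \notin B -> rooted_tree r (r |: B).
Proof.
move=> sB rs rB; apply: rooted_treeU (rooted_tree1 r) sB rs _.
by rewrite disjoints1.
Qed.

Lemma rooted_tree_add r A u w :
  rooted_tree r A -> u \in A -> w \notin A -> e u w -> rooted_tree r (w |: A).
Proof.
elim=> {r A} [r|r A s B tA IA tB IB rs dAB].
  rewrite !inE => /eqP-> wr rw; rewrite setUC.
  by apply: rooted_treeU (rooted_tree1 r) (rooted_tree1 w) rw _; rewrite disjoints1 inE eq_sym.
rewrite !inE negb_or => /orP[uA|uB] /andP[wA wB] uw.
  rewrite setUA; apply: rooted_treeU (IA uA wA uw) tB rs _.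
  by rewrite -setI_eq0 setIUl setU_eq0 !setI_eq0 disjoints1 wB.
rewrite setUCA; apply: rooted_treeU tA (IB uB wB uw) rs _.
by rewrite -setI_eq0 setIUr setU_eq0 !setI_eq0 disjoint_sym disjoints1 wA.
Qed.

Lemma rooted_tree_connect r A u : rooted_tree r A -> u \in A ->
  connect [rel x y | [&& x \in A, y \in A & e x y]] r u.
Proof.
move=> tA; elim: tA u => {r A} [r|r A s B tA IA tB IB rs dAB] u.
  by rewrite inE => /eqP->.
have mono (C D : {set V}) x y : C \subset D ->
    connect [rel x y | [&& x \in C, y \in C & e x y]] x y ->
    connect [rel x y | [&& x \in D, y \in D & e x y]] x y.
  move=> CD; apply: connect_sub => a b /and3P[aC bC ab].
  by apply: connect1; rewrite /= !(subsetP CD).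
rewrite !inE => /orP[/IA|/IB]; first exact/mono/subsetUl.
move/(mono _ (A :|: B) _ _ (subsetUr A B)); apply: connect_trans.
by apply: connect1; rewrite /= !inE (rooted_tree_root tA) (rooted_tree_root tB) orbT.
Qed.

(** A tree is grown from [r] leaf by leaf until no edge leaves it, by induction on the number of
    vertices outside. *)
Lemma rooted_tree_component r : rooted_tree r [set v | connect e r v].
Proof.
have [B [tB clB]] : exists B, rooted_tree r B /\
    forall u v, u \in B -> e u v -> v \in B.
  have: rooted_tree r [set r] by exact: rooted_tree1.
  have [n] := ubnP #|~: [set r]|; elim: n [set r] => // n IH A leA tA.
  case: (boolP [forall u in A, forall v, e u v ==> (v \in A)]).
    move=> /forall_inP clA.
    by exists A; split=> // u v /clA /forallP /(_ v) /implyP.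
  case/forall_inPn=> u uA; rewrite negb_forall => /existsP[v].
  rewrite negb_imply => /andP[uv vA].
  apply: (IH (v |: A)); last exact: rooted_tree_add tA uA vA uv.
  rewrite (leq_trans _ (_ : #|~: A| <= n)) //; apply: proper_card.
  by rewrite properC setUC properUl // sub1set.
suff -> : [set v | connect e r v] = B by [].
apply/setP=> v; rewrite inE; apply/idP/idP => [/connectP[p rp ->]|vB].
  have := rooted_tree_root tB; elim: p r rp {tB} => //= x p IH r /andP[rx xp] rB.
  by apply: IH => //; apply: clB rx.
have := rooted_tree_connect tB vB; apply: connect_sub => x y /and3P[_ _ xy].
exact: connect1.
Qed.

End RootedTrees.

Lemma rooted_tree_sub (V : finType) (e e' : rel V) r A :
  subrel e e' -> rooted_tree e r A -> rooted_tree e' r A.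
Proof.
move=> ee'; elim=> {r A} [r|r A s B _ tA _ tB rs dAB]; first exact: rooted_tree1.
exact: rooted_treeU tA tB (ee' _ _ rs) dAB.
Qed.

(** * Connectivity through common members of a family of sets *)

Section HyperConnection.
Variable V : finType.

Definition share (Bs : seq {set V}) : rel V :=
  [rel u v | has (fun B : {set V} => (u \in B) && (v \in B)) Bs].

Lemma shareP (Bs : seq {set V}) u v :
  reflect (exists B, [/\ B \in Bs, u \in B & v \in B]) (share Bs u v).
Proof.
apply: (iffP hasP) => [[B BB /andP[uB vB]]|[B [BB uB vB]]]; exists B => //.
by rewrite uB vB.
Qed.

Lemma share_sym (Bs : seq {set V}) : connect_sym (share Bs).
Proof. by apply: sym_connect_sym => u v; apply: eq_has => B; rewrite andbC. Qed.

Lemma share_mono (Bs Cs : seq {set V}) :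
  (forall B, B \in Bs -> exists2 C, C \in Cs & B \subset C) ->
  subrel (connect (share Bs)) (connect (share Cs)).
Proof.
move=> sub; apply: connect_sub => u v /shareP[B [BB uB vB]].
have [C CC BC] := sub B BB; apply/connect1/shareP; exists C.
by rewrite !(subsetP BC).
Qed.

End HyperConnection.

(** * Splitting a tree into pieces with at most [2 ^ q] vertices of [L] *)

Section Decomposition.
Variables (V : finType) (e : rel V) (L : {set V}) (q : nat).
Hypothesis q_gt0 : 0 < q.

(* [A] is decomposed into the open piece [(B0, K0)], which contains the root
   and may still grow upwards, and the closed pieces of [F]; [c] bounds the
   total number of vertices of the pieces, minus one. *)
Definition decomposable (r : V) (A : {set V}) (j c : nat) : Prop :=
  exists (B0 K0 : {set V}) (F : seq ({set V} * {set V})),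
  [/\ [/\ rooted_tree e r K0, K0 \subset A, B0 \subset K0 :&: L,
          B0 != set0 & #|B0| <= 2 ^ j],
      forall P, P \in F -> [/\ exists s, rooted_tree e s P.2,
          P.1 \subset P.2 :&: L & #|P.1| <= 2 ^ q],
      forall u b, u \in A :&: L -> b \in B0 ->
        connect (share (B0 :: map fst F)) u b &
      \sum_(P <- F) #|P.2| + #|K0| <= c.+1].

(** A path from the root to [L] is encoded as a tree [K], so that it can serve as the new open piece
    after a cut. *)
Definition near_terminal (r : V) (A : {set V}) (m : nat) : Prop :=
  exists (b : V) (K : {set V}), [/\ rooted_tree e r K, K \subset A,
    b \in K :&: L & #|K| <= m.+1].

Lemma near_terminal_cons r s m (A C : {set V}) :
  e r s -> r \notin A -> r |: A \subset C -> near_terminal s A m ->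
  near_terminal r C m.+1.
Proof.
move=> rs rA AC [b [K [tK KA bK cK]]]; exists b, (r |: K).
have rK : r \notin K by apply: contra rA; apply: (subsetP KA).
split; first exact: rooted_tree_cons tK rs rK.
- exact: subset_trans (setUS _ KA) AC.
- by move: bK; rewrite !inE => /andP[-> ->]; rewrite orbT.
- by rewrite cardsU1 rK.
Qed.

Lemma decomposable_grow r j c (A C : {set V}) :
  A \subset C -> C :&: L \subset A -> decomposable r A j c ->
  decomposable r C j c.
Proof.
move=> AC CA [B0 [K0 [F [[tK KA BK B0n cB] HF cF sF]]]]; exists B0, K0, F.
split=> //; first by split=> //; apply: subset_trans AC.
by move=> u b uC; apply: cF; rewrite inE (subsetP CA) //; case/setIP: uC.
Qed.

Lemma decomposable_cons r s j c (A C : {set V}) :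
  e r s -> r \notin A -> r |: A \subset C -> C :&: L \subset A ->
  decomposable s A j c -> decomposable r C j c.+1.
Proof.
move=> rs rA AC CA [B0 [K0 [F [[tK KA BK B0n cB] HF cF sF]]]].
have rK : r \notin K0 by apply: contra rA; apply: (subsetP KA).
exists B0, (r |: K0), F; split=> //.
- split=> //; first exact: rooted_tree_cons tK rs rK.
    exact: subset_trans (setUS _ KA) AC.
  by apply: subset_trans BK _; rewrite setSI // subsetUr.
- by move=> u b uC; apply: cF; rewrite inE (subsetP CA) //; case/setIP: uC.
- by rewrite cardsU1 rK; lia.
Qed.

(** The open pieces merge along the edge from [r] to [s], which at most doubles their bound on
    vertices of [L]. Costs are vertex counts minus one, hence [(c + d).+1]. *)
Lemma decomposable_join r s j c d (A B : {set V}) :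
  e r s -> [disjoint A & B] ->
  decomposable r A j c -> decomposable s B j d ->
  decomposable r (A :|: B) j.+1 (c + d).+1.
Proof.
move=> rs dAB [B1 [K1 [F1 [[tK1 KA1 BK1 B1n cB1] HF1 cF1 sF1]]]].
move=> [B2 [K2 [F2 [[tK2 KA2 BK2 B2n cB2] HF2 cF2 sF2]]]].
have [[b1 b1B] [b2 b2B]] := (set0Pn _ B1n, set0Pn _ B2n).
have cn u b : u \in (A :|: B) :&: L -> b \in B1 :|: B2 ->
    connect (share ((B1 :|: B2) :: map fst (F1 ++ F2))) u b.
  move=> uAB bB.
  suff [b' b'B ub'] : exists2 b', b' \in B1 :|: B2 &
      connect (share ((B1 :|: B2) :: map fst (F1 ++ F2))) u b'.
    apply: connect_trans ub' (connect1 _); apply/shareP.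
    by exists (B1 :|: B2); rewrite mem_head.
  move: uAB; rewrite setIUl inE => /orP[uA|uB].
    exists b1; first by rewrite inE b1B.
    apply: share_mono (cF1 _ _ uA b1B) => X; rewrite inE map_cat => /predU1P[->|XF].
      by exists (B1 :|: B2); rewrite ?mem_head ?subsetUl.
    by exists X => //; rewrite inE mem_cat XF orbT.
  exists b2; first by rewrite inE b2B orbT.
  apply: share_mono (cF2 _ _ uB b2B) => X; rewrite inE map_cat => /predU1P[->|XF].
    by exists (B1 :|: B2); rewrite ?mem_head ?subsetUr.
  by exists X => //; rewrite inE mem_cat XF !orbT.
exists (B1 :|: B2), (K1 :|: K2), (F1 ++ F2); split=> //.
- split; last 2 first.
  + by rewrite setU_eq0 negb_and B1n.
  + by apply: leq_trans (leq_card_setU _ _) _; rewrite expnS mul2n -addnn leq_add.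
  + apply: rooted_treeU tK1 tK2 rs _.
    exact: disjointWl KA1 (disjointWr KA2 dAB).
  + exact: setUSS.
  + by rewrite setIUl setUSS.
- by move=> P; rewrite mem_cat => /orP[/HF1|/HF2].
- have : #|K1 :|: K2| <= #|K1| + #|K2| by rewrite leq_card_setU.
  rewrite big_cat /=; lia.
Qed.

(** The open piece is closed and a path from the root to some [b] in [L] opens a new one. The path
    may overlap older pieces, so its [m.+1] vertices are paid again. *)
Lemma decomposable_close r A m c :
  near_terminal r A m -> decomposable r A q c ->
  decomposable r A 0 (c + m.+1).
Proof.
move=> [b [K [tK KA bK cK]]] [B0 [K0 [F [[tK0 KA0 BK B0n cB] HF cF sF]]]].
have [b0 b0B] := set0Pn _ B0n.
exists [set b], K, ((B0, K0) :: F); split.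
- split=> //; first by rewrite sub1set.
    by apply/set0Pn; exists b; rewrite inE.
  by rewrite cards1.
- move=> P; rewrite inE => /predU1P[->|/HF//]; split=> //.
  by exists r.
- have cn u : u \in A :&: L -> connect (share ([set b] :: map fst ((B0, K0) :: F))) u b0.
    move=> uA; apply: share_mono (cF _ _ uA b0B) => X XF.
    by exists X => //; rewrite inE XF orbT.
  move=> u _ uA /set1P->; apply: connect_trans (cn u uA) _.
  rewrite share_sym cn //; case/setIP: bK => bK bL.
  by rewrite inE (subsetP KA).
- by rewrite big_cons /=; lia.
Qed.

(* [c j] is the cost when the open piece has [j] joins left before a cut, [m] the
   distance from the root to a terminal, and [x] (0 or 1) counts the root of the
   piece that a cut at the root would close. The summand [2 * m] pays both for
   the path used by a cut here and for the one used by a later cut: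
   [2 * minn m1 m2.+1 <= m1 + m2 + 1]. *)
Lemma rooted_tree_decomposable r A : rooted_tree e r A -> A :&: L != set0 ->
  exists (c : nat -> nat) (m x : nat),
  [/\ forall j, j <= q -> decomposable r A j (c j), near_terminal r A m,
      \sum_(j < q) c j.+1 + 2 * m + x <= (q + 2) * #|A|.-1 &
      c 0 <= c q + m + x].
Proof.
elim=> {r A} [r|r A s B tA IA tB IB rs dAB].
  case/set0Pn=> u /setIP[/set1P->] rL.
  have rr : [set r] \subset [set r] :&: L by rewrite subsetI subxx sub1set.
  exists (fun=> 0), 0, 0; split=> //; last by rewrite cards1 muln0 big1.
    move=> j _; exists [set r], [set r], [::]; split=> //.
    + split=> //; first exact: rooted_tree1.
        by apply/set0Pn; exists r; rewrite inE.
      by rewrite cards1 expn_gt0.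
    + by move=> v b /setIP[/set1P-> _] /set1P->.
    + by rewrite big_nil cards1.
  exists r, [set r]; rewrite cards1; split=> //; first exact: rooted_tree1.
  by rewrite (subsetP rr) // inE.
have cAB : #|A :|: B| = #|A| + #|B| by rewrite cardsU disjoint_setI0 // cards0 subn0.
have A0 : 0 < #|A| by rewrite card_gt0; apply/set0Pn; exists r; exact: rooted_tree_root tA.
have B0 : 0 < #|B| by rewrite card_gt0; apply/set0Pn; exists s; exact: rooted_tree_root tB.
have rB : r \notin B by rewrite (disjointFr dAB) // (rooted_tree_root tA).
have rAB : r |: B \subset A :|: B by rewrite setSU // sub1set (rooted_tree_root tA).
rewrite setIUl => AB0.
(* A half without vertices of [L] is left out of the pieces, except that [r] is kept when the other
   half hangs below it. *)
case: (eqVneq (B :&: L) set0) AB0 => [BL|BL _].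
  rewrite BL setU0 => /IA[c [m [x [Hc Hm Hs H0]]]].
  exists c, m, x; split=> //.
  - move=> j jq; apply: decomposable_grow (Hc j jq); first exact: subsetUl.
    by rewrite setIUl BL setU0 subsetIl.
  - case: Hm => b [K [tK KA bK cK]]; exists b, K; split=> //.
    exact: subset_trans KA (subsetUl _ _).
  - by apply: leq_trans Hs _; rewrite leq_mul2l; apply/orP; right; lia.
have {IB BL} [c2 [m2 [x2 [Hc2 Hm2 Hs2 H02]]]] := IB BL.
case: (eqVneq (A :&: L) set0) => [AL|AL].
  exists (fun j => (c2 j).+1), m2.+1, x2; split.
  - move=> j jq; apply: decomposable_cons rs rB rAB _ (Hc2 j jq).
    by rewrite setIUl AL set0U subsetIl.
  - exact: near_terminal_cons rs rB rAB Hm2.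
  - under eq_bigr do rewrite -addn1.
    rewrite big_split /= sum1_card card_ord cAB.
    apply: (@leq_trans ((q + 2) * #|B|.-1 + (q + 2))); first by move: Hs2; move: (\sum_(_ < q) _) (_ * _.-1) => z y; lia.
    by rewrite -mulnSr leq_mul2l; apply/orP; right; lia.
  - by lia.
have {IA AL} [c1 [m1 [x1 [Hc1 Hm1 Hs1 H01]]]] := IA AL.
pose m := minn m1 m2.+1.
have Hm : near_terminal r (A :|: B) m.
  rewrite /m; case: leqP => _; last exact: near_terminal_cons rs rB rAB Hm2.
  case: Hm1 => b [K [tK KA bK cK]]; exists b, K; split=> //.
  exact: subset_trans KA (subsetUl _ _).
(* Level [j] of the join comes from level [j.-1] of both halves; level 0 comes from cutting level
   [q] at the root and adding a path. *)
pose d j := (c1 j.-1 + c2 j.-1).+1.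
have Hd j : j < q -> decomposable r (A :|: B) j.+1 (d j.+1).
  move=> jq; exact: decomposable_join rs dAB (Hc1 j (ltnW jq)) (Hc2 j (ltnW jq)).
pose d' j := if j is 0 then d q + m.+1 else d j.
have d'q : d' q = d q by case: q q_gt0.
have shift (f : nat -> nat) : \sum_(j < q) f j + f q = f 0 + \sum_(j < q) f j.+1.
  by transitivity (\sum_(j < q.+1) f j); [rewrite big_ord_recr | rewrite big_ord_recl].
exists d', m, 1; split=> //; last by rewrite d'q /= -addnA addn1.
- case=> [_|j]; last exact: Hd.
  by apply: decomposable_close => //; have := Hd q.-1; rewrite prednK //; apply.
- rewrite /d' /d /=; under eq_bigr do rewrite -addn1.
  rewrite !big_split /= sum1_card card_ord cAB.
  (* The join uses levels 0 to [q - 1] of each half, while the invariant sums levels 1 to [q]. The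
     difference [c1 0 - c1 q] is at most [m1 + x1], and likewise for [c2]. *)
  have := shift c1; have := shift c2.
  have -> : (#|A| + #|B|).-1 = #|A|.-1 + #|B|.-1 + 1 by lia.
  rewrite !mulnDr muln1 /m; move: Hs1 Hs2.
  move: (\sum_(j < q) c1 j.+1) (\sum_(j < q) c2 j.+1) (\sum_(j < q) c1 j)
    (\sum_(j < q) c2 j) (_ * #|A|.-1) (_ * #|B|.-1) => s1 s2 s3 s4 y z.
  by lia.
Qed.

End Decomposition.

(** Averaging: the costs at levels 1 to [q] sum to at most [(q + 2) * #|A|.-1], so some level costs
    at most a [q]-th of this. The vertex [b] of the open piece serves as a hub. *)
Lemma rooted_tree_pieces (V : finType) (e : rel V) (L : {set V}) q r A :
  0 < q -> rooted_tree e r A -> A :&: L != set0 ->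
  exists (F : seq ({set V} * {set V})) (b : V),
  [/\ forall P, P \in F -> [/\ exists s, rooted_tree e s P.2,
        P.1 \subset P.2 :&: L & #|P.1| <= 2 ^ q],
      exists2 P, P \in F & b \in P.1,
      forall u, u \in A :&: L -> connect (share (map fst F)) u b &
      (\sum_(P <- F) #|P.2|) * q <= (q + 2) * #|A|].
Proof.
move=> q0 tA AL; have [c [m [x [Hc _ Hs _]]]] := rooted_tree_decomposable q0 tA AL.
have A0 : 0 < #|A| by rewrite card_gt0; apply/set0Pn; exists r; exact: rooted_tree_root tA.
have [j cj] : exists j : 'I_q, c j.+1 * q <= (q + 2) * #|A|.-1.
  apply/existsP; apply: contraT; rewrite negb_exists => /forallP lt.
  have := @leq_sum _ (index_enum 'I_q) predT
    (fun=> (q + 2) * #|A|.-1 + 1) (fun j => c j.+1 * q).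
  rewrite -big_distrl /= sum_nat_const card_ord => /(_ _)/wrap[].
    by move=> j _; have := lt j; rewrite -ltnNge addn1.
  rewrite mulnC leq_pmul2r //.
  by move: Hs; move: (\sum_(_ < q) _) (_ * #|A|.-1) => z y; lia.
have [B0 [K0 [F [[tK KA BK B0n cB] HF cF sF]]]] := Hc j.+1 (ltn_ord j).
have [b bB] := set0Pn _ B0n.
exists ((B0, K0) :: F), b; split.
- move=> P; rewrite inE => /predU1P[->|/HF//]; split=> //=; first by exists r.
  by apply: leq_trans cB _; rewrite leq_exp2l.
- by exists (B0, K0); rewrite ?mem_head.
- by move=> u uA; apply: cF.
- rewrite big_cons /= addnC; apply: leq_trans (leq_mul sF (leqnn q)) _.
  rewrite mulSn; apply: leq_trans (leq_add (leqnn q) cj) _.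
  have -> : #|A| = #|A|.-1 + 1 by lia.
  rewrite mulnDr addn1 /= muln1; lia.
Qed.

(** * Clusters of linked Steiner points and their terminals *)

Section Clusters.
(* [T] are the terminals and [I] the Steiner points, with adjacencies [tadj] and
   [sadj]; [N i] are the terminals within reach of [i]. The packing hypotheses
   are what remains of the geometry when [Delta = d.+1]. *)
Variables (T I : finType) (tadj : rel T) (sadj : rel I) (N : I -> {set T}).
Variables (d q k : nat).
Hypotheses (tadj_sym : symmetric tadj) (sadj_sym : symmetric sadj).
Hypotheses (d_gt0 : 0 < d) (q_gt0 : 0 < q) (le_k : 2 ^ q * d <= k).

Definition independent (A : {set T}) :=
  {in A &, forall s t, s != t -> ~~ tadj s t}.

Hypothesis packing : forall i (A : {set T}),
  A \subset N i -> independent A -> #|A| <= d.+1.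
Hypothesis packing_adj : forall i j (A : {set T}), sadj i j ->
  A \subset N i -> [disjoint A & N j] -> independent A -> #|A| <= d.

Let tadj_csym : connect_sym tadj := sym_connect_sym tadj_sym.

(** Components are named by their [root]; the default [c] is returned only for a component out of
    reach of [i]. The fixed points in [delegates] are then one terminal per component seen by
    [i]. *)
Definition delegate i c := odflt c [pick s in N i | root tadj s == c].
Definition delegates i := [set t in N i | delegate i (root tadj t) == t].

Lemma delegates_sub i : delegates i \subset N i.
Proof. by apply/subsetP=> t; rewrite inE => /andP[]. Qed.

Lemma delegatesP i t : t \in N i -> exists2 s, s \in delegates i & connect tadj t s.
Proof.
move=> tN; rewrite /delegates.
have [s sN] : exists2 s, s \in N i & root tadj s == root tadj t /\ delegate i (root tadj t) = s.
  by rewrite /delegate; case: pickP => [s /andP[sN st]|/(_ t)]; [exists s|rewrite tN eqxx].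
move=> [/eqP st ds]; exists s; first by rewrite inE sN st ds eqxx.
by rewrite -(root_connect tadj_csym) st.
Qed.

Lemma delegates_inj i s t :
  s \in delegates i -> t \in delegates i -> connect tadj s t -> s = t.
Proof.
rewrite !inE -(root_connect tadj_csym).
by move=> /andP[_ /eqP ds] /andP[_ /eqP dt] /eqP st; rewrite -ds st dt.
Qed.

Lemma delegates_independent i : independent (delegates i).
Proof.
move=> s t sD tD; apply: contra => st; apply/eqP.
exact: delegates_inj sD tD (connect1 st).
Qed.

Definition link : rel I := [rel i j | sadj i j &&
  [forall s in delegates i, forall t in delegates j, ~~ connect tadj s t]].

Lemma link_sym : symmetric link.
Proof.
move=> i j; rewrite /link /= sadj_sym; congr (_ && _).
by apply/forall_inP/forall_inP => H s sD; apply/forall_inP => t tD;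
  rewrite tadj_csym; exact: (forall_inP (H t tD)).
Qed.

(** A delegate of [i] in [N j] would be connected to a delegate of [j], contradicting the link; so
    [packing_adj] applies. *)
Lemma card_delegates_link i j : link i j -> #|delegates i| <= d.
Proof.
case/andP=> sij /forall_inP H; apply: packing_adj sij (delegates_sub i) _ _.
  apply/pred0P=> t /=; apply/negP => /andP[tD /delegatesP[s sD ts]].
  by have /forall_inP/(_ s sD) := H t tD; rewrite ts.
exact: delegates_independent.
Qed.

Lemma not_link i j : sadj i j -> ~~ link i j ->
  exists s t, [/\ s \in delegates i, t \in delegates j & connect tadj s t].
Proof.
rewrite /link /= => ->; case/forall_inPn=> s sD /forall_inPn[t tD /negPn st].
by exists s, t.
Qed.

(** [P.2] is a feasible solution for the terminal set [P.1], which therefore costs at most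
    [#|P.2|]. *)
Definition hyperedges_of (F : seq ({set T} * {set I})) : Prop :=
  forall P, P \in F -> [/\ #|P.1| <= k, exists s, rooted_tree sadj s P.2 &
    forall t, t \in P.1 -> exists2 i, i \in P.2 & t \in N i].

Lemma cluster_cover r : exists F : seq ({set T} * {set I}),
  [/\ hyperedges_of F,
      forall i j s t, connect link r i -> connect link r j ->
        s \in delegates i -> t \in delegates j ->
        connect (share (map fst F)) s t &
      (\sum_(P <- F) #|P.2|) * q <= (q + 2) * #|[set v | connect link r v]|].
Proof.
have tr := rooted_tree_component link r.
set K := [set v | connect link r v] in tr *.
pose L := [set i in K | delegates i != set0].
have inL i s : connect link r i -> s \in delegates i -> i \in K :&: L.
  by move=> ri sD; rewrite !inE ri; apply/set0Pn; exists s.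
have link_sadj : subrel link sadj by move=> i j /andP[].
case: (eqVneq (K :&: L) set0) => [KL|KL].
  exists [::]; split=> //; last by rewrite big_nil.
  by move=> i j s t ri _ sD _; have := inL _ _ ri sD; rewrite KL inE.
(* An isolated Steiner point has only the weaker bound [d.+1], which suffices:
   [d.+1 <= 2 * d <= 2 ^ q * d <= k]. *)
case: (eqVneq K [set r]) => [Kr|Kr].
  exists [:: (delegates r, [set r])]; split.
  - move=> P; rewrite inE => /eqP-> /=; split.
    + apply: leq_trans (packing (delegates_sub r) (@delegates_independent r)) _.
      apply: leq_trans le_k; case: q q_gt0 => // q' _; rewrite expnS.
      by have := expn_gt0 2 q'; nia.
    + by exists r; exact: rooted_tree1.
    + by move=> t /(subsetP (delegates_sub r)) tN; exists r; rewrite ?inE.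
  - have Kin i : connect link r i -> i = r.
      by move=> ri; apply/set1P; rewrite -Kr inE.
    move=> i j s t /Kin-> /Kin-> sD tD; apply/connect1/shareP.
    by exists (delegates r); rewrite mem_head.
  - by rewrite big_seq1 /= Kr cards1; lia.
(* In a cluster of at least two points, each point has a linked neighbour and hence at most [d]
   delegates. *)
have cardD i : i \in K -> #|delegates i| <= d.
  move=> iK; have [j jK ji] : exists2 j, j \in K & j != i.
    case: (eqVneq r i) => [<-|ri]; last by exists r; rewrite // inE connect0.
    apply/exists_inP; apply: contraR Kr; rewrite negb_exists_in => /forall_inP H.
    apply/eqP/setP=> x; rewrite inE; apply/idP/eqP => [xK|->]; last by rewrite inE connect0.
    by have := H x xK; rewrite negbK => /eqP.
  have /connectP[[|x p] /=] : connect link i j.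
  - move: iK jK; rewrite !inE (sym_connect_sym link_sym r i) => ir rj.
    exact: connect_trans ir rj.
  - by move=> _ /eqP; rewrite (negbTE ji).
  - by case/andP=> ix _ _; exact: card_delegates_link ix.
have [F [b [HF [P0 P0F bP0] cF sF]]] := rooted_tree_pieces q_gt0 tr KL.
pose g (P : {set I} * {set I}) := (\bigcup_(i in P.1) delegates i, P.2).
exists (map g F); split; last by rewrite big_map.
- move=> _ /mapP[P PF ->]; have [[s ts] PL cP] := HF P PF; split=> /=.
  + apply: leq_trans le_k; apply: leq_trans (leq_mul cP (leqnn d)).
    rewrite -sum_nat_const.
    apply: (big_ind2 (fun (X : {set T}) n => #|X| <= n)) => [|X m Y n Xm Yn|i iP].
    - by rewrite cards0.
    - by apply: leq_trans (leq_add Xm Yn); rewrite leq_card_setU.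
    - by apply: cardD; have := subsetP PL _ iP; rewrite !inE => /and3P[].
  + by exists s; apply: rooted_tree_sub ts.
  + move=> t /bigcupP[i iP tD]; exists i; last exact: subsetP (delegates_sub i) _ tD.
    by have := subsetP PL _ iP; rewrite !inE => /andP[].
- pose conn := connect (share (map fst (map g F))).
  have step i j s t P : P \in F -> i \in P.1 -> j \in P.1 -> s \in delegates i ->
      t \in delegates j -> conn s t.
    move=> PF iP jP sD tD; apply/connect1/shareP; exists (g P).1.
    by split; [exact/map_f/map_f | apply/bigcupP; exists i | apply/bigcupP; exists j].
  (* Consecutive Steiner points of the path lie in a common piece, so their delegates share a
     hyperedge; delegates exist because these points are in [L]. *)
  have cb i s t : i \in K :&: L -> s \in delegates i -> t \in delegates b -> conn t s.
    move=> /cF; rewrite share_sym => /connectP[p bp ->] {i}.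
    elim/last_ind: p bp s => [_|p i IH] /=; first by move=> s sD tD; apply: (step b b t s P0).
    rewrite rcons_path last_rcons => /andP[/IH IHp /shareP[_ [/mapP[P PF ->] xP iP]]] s sD tD.
    have /set0Pn[x xD] : delegates (last b p) != set0.
      by have [_ /subsetP/(_ _ xP) + _] := HF P PF; rewrite !inE => /and3P[].
    by apply: connect_trans (IHp _ xD tD) _; apply: step PF xP iP _ _.
  have /set0Pn[x xD] : delegates b != set0.
    by have [_ /subsetP/(_ _ bP0) + _] := HF P0 P0F; rewrite !inE => /and3P[].
  move=> i j s t ri rj sD tD; apply: (@connect_trans _ _ x).
    by rewrite share_sym; apply: cb (inL _ _ ri sD) _ _.
  exact: cb (inL _ _ rj tD) tD xD.
Qed.

Definition steiner_graph : rel (T + I) := fun x y =>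
  match x, y with
  | inl s, inl t => tadj s t
  | inl t, inr i | inr i, inl t => t \in N i
  | inr i, inr j => sadj i j
  end.

Lemma steiner_cover :
  (forall s t, connect steiner_graph (inl s) (inl t)) ->
  exists F : seq ({set T} * {set I}),
  [/\ hyperedges_of F,
      forall s t, connect (relU tadj (share (map fst F))) s t &
      (\sum_(P <- F) #|P.2|) * q <= (q + 2) * #|I|].
Proof.
move=> Hconn.
have [f Hf] := fin_all_exists cluster_cover.
have lsym := sym_connect_sym link_sym.
pose F := flatten [seq f r | r <- enum (roots link)].
have inF r P : roots link r -> P \in f r -> P \in F.
  by move=> rr Pr; apply/flatten_mapP; exists r; rewrite ?mem_enum.
exists F; split.
- by move=> P /flatten_mapP[r _]; case: (Hf r) => H _ _; apply: H.
- set e := relU _ _.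
  have esym : connect_sym e.
    apply: sym_connect_sym => x y; rewrite /e /= tadj_sym; congr (_ || _).
    by apply: eq_has => B; rewrite andbC.
  have tadj_e : subrel (connect tadj) (connect e).
    by apply: connect_sub => x y xy; apply: connect1; rewrite /e /= xy.
  have cluster i j s t : connect link i j -> s \in delegates i -> t \in delegates j ->
      connect e s t.
    move=> ij sD tD; have [_ H _] := Hf (root link i).
    have ri : connect link (root link i) i by rewrite lsym connect_root.
    have := H i j s t ri (connect_trans ri ij) sD tD.
    apply: connect_sub => x y /shareP[B [/mapP[P Pf ->] xP yP]].
    apply: connect1; rewrite /e /=; apply/orP; right; apply/shareP; exists P.1.
    by split=> //; apply/map_f/(inF (root link i))=> //; exact: roots_root.
  move=> u v; have /connectP[p up vp] := Hconn u v.
  (* The walk may leave a cluster at another point than it entered, so at a Steiner point the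
     invariant concerns the delegates of the whole cluster. *)
  pose inv (x : T + I) : Prop := match x with inl t => connect e u t
    | inr i => forall j t, connect link i j -> t \in delegates j -> connect e u t end.
  have invN i t : t \in N i -> connect e u t -> inv (inr i).
    move=> /delegatesP[s sD ts] ut j x ij xD.
    apply: connect_trans (connect_trans ut (tadj_e _ _ ts)) _.
    exact: cluster ij sD xD.
  suff : inv (last (inl u) p) by rewrite -vp.
  have : inv (inl u) by exact: connect0.
  elim: p (inl u : T + I) up {vp} => //= y p IH x /andP[xy yp] ix.
  apply: IH yp _; case: x y xy ix => [s|i] [t|j] /= xy ix.
  + exact: connect_trans ix (tadj_e _ _ (connect1 xy)).
  + exact: invN xy ix.
  + have [s sD ts] := delegatesP xy.
    by apply: connect_trans (ix _ _ (connect0 _ i) sD) _; rewrite esym tadj_e.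
  + case: (boolP (link i j)) => [ij|nij].
      by move=> l t jl; apply: ix; apply: connect_trans (connect1 ij) jl.
    (* A discarded edge is bypassed through a component within reach of both ends. *)
    have [s [t [sD tD st]]] := not_link xy nij.
    move=> l x jl xD; apply: connect_trans (cluster _ _ _ _ jl tD xD).
    exact: connect_trans (ix _ _ (connect0 _ i) sD) (tadj_e _ _ st).
- rewrite big_flatten big_map big_enum /= big_distrl /=.
  apply: (@leq_trans (\sum_(r in roots link) (q + 2) * #|[set v | connect link r v]|)).
    by apply: leq_sum => r _; case: (Hf r).
  rewrite -big_distrr leq_mul2l -(cardsT I) -[#|[set: I]|]sum1_card; apply/orP; right.
  rewrite [leqRHS](partition_big (root link) (mem (roots link))) /=; last first.
    by move=> v _; exact: roots_root.
  apply: leq_sum => r rr; rewrite -sum1_card.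
  rewrite (eq_bigl (fun v => (v \in [set: I]) && (root link v == r))) // => v.
  by rewrite !inE -(root_connect lsym) (eqP rr) eq_sym.
Qed.


End Clusters.

(* Imported only here because [all_classical] shadows names of [finset]. *)
From mathcomp Require Import all_order all_algebra finmap.
From mathcomp Require Import all_classical all_reals all_analysis.
Import Order.TTheory GRing.Theory Num.Theory.
Import numFieldNormedType.Exports.
Local Open Scope fset_scope.
Local Open Scope ring_scope.

(** Different pieces may have the same terminals; passing to a finite set drops only repeated
    nonnegative terms. *)
Lemma sum_fset_seq_le (R : realType) (K : choiceType) (s : seq K)
    (f : K -> \bar R) : (forall x, 0 <= f x)%E ->
  (\sum_(x <- [fset x in s]) f x <= \sum_(x <- s) f x)%E.
Proof.
move=> f0; have -> : (\sum_(x <- [fset x in s]) f x = \sum_(x <- undup s) f x)%E.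
  apply: perm_big; apply: uniq_perm; rewrite ?fset_uniq ?undup_uniq // => x.
  by rewrite mem_undup !inE.
elim: s => //= x s IH; rewrite [leRHS]big_cons; case: ifP => _.
  by apply: le_trans IH _; rewrite leeDr.
by rewrite big_cons leeD2l.
Qed.

(** * Packings in unit balls and the bounds on [opt] and [tau] *)

Section Geometry.
Variables (R : realType) (M : normedModType R).
Implicit Types (T A : {fset M}) (Delta k n : nat).

Lemma opt_ge0 T : (0 <= opt T)%E.
Proof. by apply: le_ereal_inf_tmp => _ [n _ <-]; rewrite lee_fin. Qed.

Lemma opt_le T n (S : n.-tuple M) :
  steiner_feasible T S -> (opt T <= (n%:R : R)%:E)%E.
Proof. by move=> fS; apply: ereal_inf_lbound; exists n => //; exists S. Qed.

Lemma tau_ge0 k T : (0 <= tau k T)%E.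
Proof.
apply: le_ereal_inf_tmp => _ [F _ <-]; apply: sume_ge0 => A _; exact: opt_ge0.
Qed.

Lemma tau_le k T (F : {fset {fset M}}) :
  connected_spanning k T F -> (tau k T <= \sum_(A <- F) opt A)%E.
Proof. by move=> cF; apply: ereal_inf_lbound; exists F. Qed.

Definition terminals T (A : {set T}) : {fset M} := [fset val x | x in A].

Lemma terminals_sub T (A : {set T}) : terminals A `<=` T.
Proof. by apply/fsubsetP=> _ /imfsetP[x _ ->]; exact: valP. Qed.

Lemma mem_terminals T (A : {set T}) (x : T) : (val x \in terminals A) = (x \in A).
Proof.
apply/imfsetP/idP => [[y yA /val_inj->]//|xA]; by exists x.
Qed.

Lemma card_terminals T (A : {set T}) : #|` terminals A| = #|A|.
Proof. by rewrite card_imfset //=; [rewrite -cardE | exact: val_inj]. Qed.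

Lemma unit_disk_sym (V : finType) (loc : V -> M) : symmetric (unit_disk loc).
Proof. by move=> u v; rewrite /unit_disk /= eq_sym distrC. Qed.

Definition disk T n (S : n.-tuple M) (i : 'I_n) : {set T} :=
  finset (fun t : T => `|tnth S i - val t| <= 1).

Definition close T : rel T := [rel s t | `|val s - val t| <= 1].

Definition close_steiner n (S : n.-tuple M) : rel 'I_n :=
  [rel i j | `|tnth S i - tnth S j| <= 1].

Lemma packing_disk Delta T n (S : n.-tuple M) i (A : {set T}) :
  is_packing_number M Delta -> A \subset disk T S i ->
  independent (@close T) A -> (#|A| <= Delta)%N.
Proof.
move=> [_ max] AN iA; rewrite -card_terminals; apply: max; split.
  exists (tnth S i) => _ /imfsetP[x xA ->].
  by have := fintype.subsetP AN _ xA; rewrite inE distrC.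
move=> _ _ /imfsetP[x xA ->] /imfsetP[y yA ->] xy.
by rewrite ltNge; apply: iA => //; apply: contra_neq xy => ->.
Qed.

(** The location of [j] can be added to [A]: it is in the ball around [i] and far from [A]. This
    extra point makes the bound strict. *)
Lemma packing_disk_adj Delta T n (S : n.-tuple M) i j (A : {set T}) :
  is_packing_number M Delta -> close_steiner S i j ->
  A \subset disk T S i -> [disjoint A & disk T S j]%B ->
  independent (@close T) A -> (#|A| < Delta)%N.
Proof.
move=> [_ max] sij AN dA iA; rewrite -card_terminals.
have far x : x \in A -> 1 < `|tnth S j - val x|.
  by move=> xA; have := disjointFr dA xA; rewrite inE => /negbT; rewrite -ltNge.
have jA : tnth S j \notin terminals A.
  apply/negP => /imfsetP[x /far + jx]; rewrite jx subrr normr0.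
  by rewrite ltNge ler01.
suff /max : unit_packing (tnth S j |` terminals A) by rewrite cardfsU1 jA.
split.
  exists (tnth S i) => x; rewrite !inE => /predU1P[->|/imfsetP[y yA ->]].
    by rewrite distrC.
  by have := fintype.subsetP AN _ yA; rewrite inE distrC.
move=> x y; rewrite !inE.
move=> /predU1P[->|/imfsetP[a aA ->]] /predU1P[->|/imfsetP[b bA ->]] xy.
- by rewrite eqxx in xy.
- exact: far.
- by rewrite distrC; exact: far.
- by rewrite ltNge; apply: iA => //; apply: contra_neq xy => ->.
Qed.

(** The points of [K], reindexed by rank, are feasible: the tree connects them and each terminal is
    near one of them. *)
Lemma opt_terminals_le T n (S : n.-tuple M) s (K : {set 'I_n}) (A : {set T}) :
  rooted_tree (close_steiner S) s K ->
  (forall t, t \in A -> exists2 i, i \in K & t \in disk T S i) ->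
  (opt (terminals A) <= (#|K|%:R : R)%:E)%E.
Proof.
move=> tK AK; pose S' : #|K|.-tuple M := [tuple tnth S (enum_val i) | i < #|K|].
have sK := rooted_tree_root tK.
apply: (@opt_le _ _ S'); rewrite /steiner_feasible; set G := unit_disk _.
have Gsym : connect_sym G by exact/sym_connect_sym/unit_disk_sym.
pose h i : terminals A + 'I_#|K| := inr (enum_rank_in sK i).
have S'h i : i \in K -> location S' (h i) = tnth S i.
  by move=> iK; rewrite /= tnth_mktuple enum_rankK_in.
have GS x y : `|location S' x - location S' y| <= 1 -> connect G x y.
  by case: (eqVneq x y) => [->//|xy] xy1; exact/connect1/andP.
have cK i : i \in K -> connect G (h s) (h i).
  move=> /(rooted_tree_connect tK); apply: connect_homo => x y /and3P[xK yK xy].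
  by apply: GS; rewrite !S'h.
have cA a : connect G (h s) (inl a).
  have /imfsetP[t tA at_] := valP a; have [i iK ti] := AK t tA.
  apply: connect_trans (cK i iK) (GS _ _ _); rewrite S'h //=.
  by move: ti; rewrite inE -at_.
by move=> a b; apply: connect_trans (cA b); rewrite Gsym.
Qed.

Lemma opt_pair_le0 (x y : M) : `|x - y| <= 1 -> (opt [fset x; y] <= 0)%E.
Proof.
move=> xy; apply: (@opt_le _ 0 [tuple]) => s t.
case: (eqVneq s t) => [->//|st]; apply/connect1/andP; split=> //=.
have := valP s; have := valP t; rewrite !inE.
move=> /orP[]/eqP-> /orP[]/eqP->; rewrite ?subrr ?normr0 ?ler01 //.
by rewrite distrC.
Qed.

Lemma tau_le_feasible Delta k q T n (S : n.-tuple M) :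
  is_packing_number M Delta -> (1 < Delta)%N -> (0 < q)%N ->
  (2 ^ q * (Delta - 1) <= k)%N -> steiner_feasible T S ->
  (tau k T <= ((1 + 2 / q%:R) * n%:R : R)%:E)%E.
Proof.
move=> hD D1 q0 hk fS.
have csym : symmetric (@close T) by move=> x y; rewrite /close /= distrC.
have ssym : symmetric (close_steiner S) by move=> x y; rewrite /close_steiner /= distrC.
have d0 : (0 < Delta - 1)%N by rewrite subn_gt0.
have D1E : (Delta - 1).+1 = Delta by rewrite subn1 prednK // ltnW.
have [||u v|F [HF cF sF]] := steiner_cover csym ssym d0 q0 hk
    (N := disk T S).
- by move=> i A; rewrite D1E; exact: packing_disk.
- by move=> i j A ij AN dA iA; rewrite -ltnS D1E; exact: packing_disk_adj ij AN dA iA.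
- apply: connect_sub (fS u v) => x y /andP[_ xy]; apply: connect1.
  by case: x y xy => [s|i] [t|j] //=; rewrite inE // distrC.
(* Pieces with fewer than two terminals connect nothing and are dropped. The pairs in [s2] cost 0
   and replace the edges between terminals. *)
pose s1 := [seq terminals P.1 | P : {set T} * {set 'I_n} <- F & (1 < #|P.1|)%N].
pose s2 := [seq [fset val p.1; val p.2] | p : T * T <- enum {: T * T} & (p.1 != p.2) && close p.1 p.2].
have k2 : (1 < k)%N.
  apply: leq_trans hk; apply: leq_trans (leq_mul (leq_pexp2l _ q0) d0) => //.
have cs : connected_spanning k T [fset A in s1 ++ s2].
  split.
    move=> A; rewrite !inE; move=> /orP[/mapP[P]|/mapP[[x y]]].
      rewrite mem_filter => /andP[P1 PF] ->; have [Pk _ _] := HF P PF.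
      by rewrite /hyperedge terminals_sub card_terminals P1.
    rewrite mem_filter /= => /andP[/andP[xy _] _] ->.
    rewrite /hyperedge cardfs2 (inj_eq val_inj) xy /= k2 andbT.
    by apply/fsubsetP => z; rewrite !inE => /orP[]/eqP->; exact: valP.
  move=> u v; apply: connect_sub (cF u v) => x y xy.
  case: (eqVneq x y) => [->//|nxy]; apply: connect1; apply/existsP.
  suff [A As /andP[xA yA]] : exists2 A, A \in [fset A in s1 ++ s2] &
      (val x \in A) && (val y \in A) by exists [` As]; rewrite /= xA yA.
  case/orP: xy => [xy|/shareP[B [/mapP[P PF ->] xP yP]]].
    exists [fset val x; val y]; last by rewrite !inE !eqxx orbT.
    rewrite !inE; apply/orP; right; apply/mapP; exists (x, y) => //.
    by rewrite mem_filter /= nxy xy mem_enum.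
  exists (terminals P.1); last by rewrite !mem_terminals xP yP.
  rewrite !inE; apply/orP; left; apply/mapP; exists P => //.
  rewrite mem_filter PF andbT; apply/card_gt1P; exists x, y; split=> //.
apply: le_trans (tau_le cs) _; apply: le_trans (sum_fset_seq_le _ opt_ge0) _.
rewrite big_cat /=.
have -> : (\sum_(A <- s2) opt A = 0)%E.
  rewrite big_seq big1 // => A /mapP[[x y]]; rewrite mem_filter => /andP[/andP[_ xy] _] ->.
  by apply/eqP; rewrite eq_le opt_ge0 opt_pair_le0.
rewrite adde0 /s1 big_map big_filter.
apply: (@le_trans _ _ (\sum_(P <- F) (#|P.2|%:R : R)%:E)%E).
  rewrite big_mkcond big_seq [leRHS]big_seq; apply: lee_sum => P PF.
  case: ifP => _; last by rewrite lee_fin.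
  by have [_ [s ts] H] := HF P PF; exact: opt_terminals_le ts H.
rewrite sumEFin lee_fin -natr_sum; move: sF; move: (\sum_(P <- F) #|P.2|)%N => z.
rewrite card_ord => zq; have q0' : 0 < q%:R :> R by rewrite ltr0n.
rewrite -(ler_pM2r q0') mulrAC mulrDl divfK ?gt_eqF // mul1r -natrM -natrD -natrM ler_nat.
exact: zq.
Qed.

Lemma opt_attained T : opt T = +oo%E \/
  exists n (S : n.-tuple M), steiner_feasible T S /\ opt T = (n%:R : R)%:E.
Proof.
pose P n := `[< exists S : n.-tuple M, steiner_feasible T S >].
have [exP|noP] := pselect (exists n, P n); last first.
  left; apply/ereal_inf_pinfty => x [n [S fS] _]; case: noP.
  by exists n; apply/asboolP; exists S.
right; case: (ex_minnP exP) => n /asboolP[S fS] min; exists n, S; split=> //.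
apply/eqP; rewrite eq_le (opt_le fS); apply: le_ereal_inf_tmp => _ [m [S' fS'] <-].
by rewrite lee_fin ler_nat; apply: min; apply/asboolP; exists S'.
Qed.

(** Two distinct points yield a unit vector [a]; then [a] and [- a], at distance 2, form a packing
    of the ball around 0. *)
Lemma packing_number_le1 Delta (x y : M) :
  is_packing_number M Delta -> (Delta <= 1)%N -> x = y.
Proof.
move=> [_ max] D1; apply/eqP; apply: contraTT D1 => xy; rewrite -ltnNge.
pose a := `|x - y|^-1 *: (x - y).
have a1 : `|a| = 1.
  by rewrite normrZ normfV normr_id mulVf // normr_eq0 subr_eq0.
have aa : 1 < `|a - (- a)|.
  by rewrite opprK -mulr2n normrMn a1 ltr1n.
have na : a != - a by rewrite -subr_eq0 -normr_gt0 (lt_trans ltr01).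
have := max [fset a; - a]; rewrite cardfs2 na; apply; split.
  exists 0 => z; rewrite !inE subr0 => /orP[]/eqP->; by rewrite ?normrN a1.
move=> u v; rewrite !inE => /orP[]/eqP-> /orP[]/eqP->; rewrite ?eqxx // => _.
by rewrite distrC.
Qed.

Lemma tau_subsingleton k T : (forall x y : M, x = y) -> tau k T = 0%E.
Proof.
move=> xy; apply/eqP; rewrite eq_le tau_ge0 andbT.
have /tau_le : connected_spanning k T fset0.
  split=> [A|u v]; first by rewrite inE.
  by rewrite (val_inj (xy (val u) (val v))).
by rewrite big_seq_fset0.
Qed.

Lemma k_ratio_le Delta k q :
  is_packing_number M Delta -> (1 < Delta)%N -> (0 < q)%N ->
  (2 ^ q * (Delta - 1) <= k)%N -> (k_ratio M k <= (1 + 2 / q%:R : R)%:E)%E.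
Proof.
move=> hD D1 q0 hk; apply: ge_ereal_sup => _ [T _ <-].
have c0 : 0 <= 1 + 2 / q%:R :> R by rewrite addr_ge0 ?divr_ge0.
(* If [opt T] is infinite, its inverse is 0 and so is the ratio. *)
have [->|[n [S [fS ->]]]] := opt_attained T.
  by rewrite invey mule0 lee_fin.
have := tau_le_feasible hD D1 q0 hk fS.
case: n S fS => [|n] S fS.
  (* When [opt T] is 0, the bound forces [tau k T = 0], and the ratio is 0 by convention. *)
  rewrite mulr0 => t0; have -> : tau k T = 0%E.
    by apply/eqP; rewrite eq_le t0 tau_ge0.
  by rewrite mul0e lee_fin.
by rewrite inver pnatr_eq0 /= lee_pdivrMr ?ltr0n // -EFinM.
Qed.

End Geometry.

(** * The choice of [q] as the floor of a binary logarithm *)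

Lemma floor_lg_nat (R : realType) (n : nat) : (1 < n)%N ->
  exists q, [/\ (0 < q)%N, (2 ^ q <= n)%N & Num.floor (lg (n%:R : R)) = q%:Z].
Proof.
move=> n1; have l2 : 0 < ln 2 :> R by rewrite ln_gt0 // ltr1n.
have n0 : 0 < n%:R :> R by rewrite ltr0n ltnW.
have f1 : 1 <= Num.floor (lg (n%:R : R)).
  by rewrite floor_ge_int ler_pdivlMr // mul1r ler_ln ?posrE // ler_nat.
case E : (Num.floor _) f1 => [q|//] q1; exists q; split=> //.
have : (q%:Z)%:~R <= lg (n%:R : R) by rewrite -E floor_le.
rewrite ler_pdivlMr // -pmulrn mulr_natl -lnXn // ler_ln ?posrE ?exprn_gt0 //.
by rewrite -natrX ler_nat.
Qed.

Theorem theorem4 (R : realType) (M : normedModType R) (Delta : nat)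
    (hDelta : is_packing_number M Delta)
    (k : nat) (hk : (2 * Delta - 2 <= k)%N) :
  (k_ratio M k <=
    (1 + 2 / (Num.floor (lg ((k %/ (Delta - 1))%N%:R : R)))%:~R)%:E)%E.
Proof.
have [D1|D1] := leqP Delta 1.
  have xy (x y : M) : x = y by exact: packing_number_le1 hDelta D1.
  (* In the one-point space the conventions [k %/ 0 = 0], [ln 0 = 0] and [2 / 0 = 0] turn the bound
     into 1. *)
  have -> : (Delta - 1 = 0)%N by apply/eqP; rewrite subn_eq0.
  rewrite divn0 /lg ln0 // mul0r floor0 invr0 mulr0 addr0.
  apply: ge_ereal_sup => _ [T _ <-]; rewrite tau_subsingleton // mul0e.
  by rewrite lee_fin.
have d0 : (0 < Delta - 1)%N by rewrite subn_gt0.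
(* This is where [hk] enters: a quotient of at least 2 makes [q] positive. *)
have k1 : (1 < k %/ (Delta - 1))%N by rewrite leq_divRL // mulnBr muln1.
have [q [q0 q2 ->]] := floor_lg_nat R k1.
by apply: k_ratio_le hDelta D1 q0 _; rewrite -leq_divRL.
Qed.
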